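(* For all integers $m\ge2$, every $(\mathbf p,m)$-admissible mesh is analysis-suitable, i.e. $\mathbb A^{\mathbf p,m}\subseteq\mathbb{AS}^{\mathbf p}$.
   Context: Parameters: $\mathbf p=(p_1,p_2,p_3)$ with each $p_i\ge 3$ an odd integer; $m\ge2$ an integer (grading parameter); positive integers $\tilde X,\tilde Y,\tilde Z$. Initial mesh: $\mathcal G_0=\{[x-1,x]\times[y-1,y]\times[z-1,z] : x\in\{1,\dots,\tilde X\},y\in\{1,\dots,\tilde Y\},z\in\{1,\dots,\tilde Z\}\}$, partitioning $\Omega=(0,\tilde X)\times(0,\tilde Y)\times(0,\tilde Z)$. Elements are closed axis-parallel boxes arising from elements of $\mathcal G_0$ by successive subdivision as below. The level of an element $K$ is $\ell(K)=-\log_m|K|$ ($|K|$ = volume). Subdivision: for an element $K$, $\operatorname{child}(K)$ is the set of the $m$ boxes obtained by cutting $K$ into $m$ congruent boxes by planes orthogonal to the $x$-axis if $\ell(K)\equiv0$, to the $y$-axis if $\ell(K)\equiv1$, to the $z$-axis if $\ell(K)\equiv2\pmod 3$. For $K\in\mathcal G$, $\operatorname{subdiv}(\mathcal G,K)=(\mathcal G\setminus\{K\})\cup\operatorname{child}(K)$; for $\mathcal M=\{K_1,\dots,K_J\}\subseteq\mathcal G$, $\operatorname{subdiv}(\mathcal G,\mathcal M)$ is the result of successively subdividing all $K_j$ (in any order). Patches: for $x\in\overline\Omega$, $\operatorname{Dist}(K,x)\in\mathbb R^3$ is the componentwise absolute value of $\operatorname{mid}(K)-x$, with $\operatorname{mid}(K)$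 the midpoint of $K$. For $k\ge0$, $$\mathbf D^{\mathbf p,m}(k)=\begin{cases}m^{-k/3}(p_1+\frac32,\,p_2+\frac32,\,p_3+\frac32)&k\equiv0\bmod 3,\\ m^{-(k-1)/3}(\frac{p_1+3/2}m,\,p_2+\frac32,\,p_3+\frac32)&k\equiv1\bmod 3,\\ m^{-(k-2)/3}(\frac{p_1+3/2}m,\,\frac{p_2+3/2}m,\,p_3+\frac32)&k\equiv2\bmod 3.\end{cases}$$ Set $U^{\mathbf p,m}(K)=\{x\in\Omega:\operatorname{Dist}(K,x)<\mathbf D^{\mathbf p,m}(\ell(K))\}$ (componentwise inequality), and the $(\mathbf p,m)$-patch $\mathcal G^{\mathbf p,m}(K)=\{K'\in\mathcal G: K'\cap U^{\mathbf p,m}(K)\ne\emptyset\}$. Admissibility: for $K\in\mathcal G$, $\operatorname{subdiv}(\mathcal G,K)$ is admissible if $\ell(K')\ge\ell(K)$ for all $K'\in\mathcal G^{\mathbf p,m}(K)$. For $\mathcal M=\{K_1,\dots,K_J\}\subseteq\mathcal G$, $\operatorname{subdiv}(\mathcal G,\mathcal M)$ is admissible if for some ordering of the $K_j$ it is a concatenation of admissible subdivisions of single elements. A mesh $\mathcal G$ is $(\mathbf p,m)$-admissible if there are meshes $\mathcal G_1,\dots,\mathcal G_J=\mathcal G$ (starting from the initial mesh $\mathcal G_0$) and $\mathcal M_j\subseteq\mathcal G_j$ such that $\mathcal G_{j+1}=\operatorname{subdiv}(\mathcal G_j,\mathcal M_j)$ is an admissible subdivision for all $j=0,\dots,J-1$.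 $\mathbb A^{\mathbf p,m}$ is the set of all admissible meshes, including $\mathcal G_0$. T-splines on a mesh $\mathcal G$: The nodes $\mathcal N$ are all vertices of all elements of $\mathcal G$. The active region is $\mathcal{AR}=[\lceil\frac{p_1}2\rceil,\tilde X-\lceil\frac{p_1}2\rceil]\times[\lceil\frac{p_2}2\rceil,\tilde Y-\lceil\frac{p_2}2\rceil]\times[\lceil\frac{p_3}2\rceil,\tilde Z-\lceil\frac{p_3}2\rceil]$, and $\mathcal N_A=\mathcal N\cap\mathcal{AR}$ is the set of active nodes. The $x$-orthogonal skeleton $\Xi_{\mathrm x}$ is the union of all closed element faces orthogonal to the $x$-axis, i.e. of the sets $\{x,x+\tilde x\}\times[y,y+\tilde y]\times[z,z+\tilde z]$ over all $[x,x+\tilde x]\times[y,y+\tilde y]\times[z,z+\tilde z]\in\mathcal G$; $\Xi_{\mathrm y},\Xi_{\mathrm z}$ are defined analogously. Global index sets: $\mathbf X(y,z)=\{\tilde x\in[0,\tilde X]:(\tilde x,y,z)\in\Xi_{\mathrm x}\}$, $\mathbf Y(x,z)=\{\tilde y\in[0,\tilde Y]:(x,\tilde y,z)\in\Xi_{\mathrm y}\}$, $\mathbf Z(x,y)=\{\tilde z\in[0,\tilde Z]:(x,y,\tilde z)\in\Xi_{\mathrm z}\}$. For $v=(v_1,v_2,v_3)\in\mathcal N_A$, the local index vector $\mathbf x(v)\in\mathbb R^{p_1+2}$ consists of the unique $p_1+2$ consecutive elements of $\mathbf X(v_2,v_3)$ having $v_1$ as middle ($\frac{p_1+3}2$-th)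 entry; $\mathbf y(v)\in\mathbb R^{p_2+2}$ and $\mathbf z(v)\in\mathbb R^{p_3+2}$ are defined analogously from $\mathbf Y(v_1,v_3)$, $\mathbf Z(v_1,v_2)$. The T-spline blending function is $B_v(x,y,z)=N_{\mathbf x(v)}(x)N_{\mathbf y(v)}(y)N_{\mathbf z(v)}(z)$, where $N_X$ is the univariate B-spline of degree $p$ on the knot vector $X=(x_1,\dots,x_{p+2})$; its (closed) support $\operatorname{supp}B_v$ is the product of the closed intervals between first and last entries of the three local index vectors. Analysis-suitability: for $q\in\mathbb R$ let $\mathcal S_{\mathrm x}(q)=\{(\tilde x,\tilde y,\tilde z)\in\mathcal{AR}:\tilde x=q\}$, $\mathcal N_{\mathrm x}(q)=\{(v_1,v_2,v_3)\in\mathcal N_A:(q,v_2,v_3)\in\Xi_{\mathrm x}\}$, and $$\mathcal R_{\mathrm x}(q)=\mathcal S_{\mathrm x}(q)\cap\bigcup_{v\in\mathcal N_{\mathrm x}(q)}\operatorname{supp}B_v\cap\bigcup_{v\in\mathcal N_A\setminus\mathcal N_{\mathrm x}(q)}\operatorname{supp}B_v,\qquad \mathcal R_{\mathrm x}=\bigcup_{q\in\mathbb R}\mathcal R_{\mathrm x}(q).$$ Define $\mathcal R_{\mathrm y}$ and $\mathcal R_{\mathrm z}$ analogously, with $\mathcal S_{\mathrm y}(r)=\{(\tilde x,\tilde y,\tilde z)\in\mathcal{AR}:\tilde y=r\}$, $\mathcal N_{\mathrm y}(r)=\{v\in\mathcal N_A:(v_1,r,v_3)\in\Xi_{\mathrm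 y}\}$ and $\mathcal S_{\mathrm z}(s)=\{(\tilde x,\tilde y,\tilde z)\in\mathcal{AR}:\tilde z=s\}$, $\mathcal N_{\mathrm z}(s)=\{v\in\mathcal N_A:(v_1,v_2,s)\in\Xi_{\mathrm z}\}$. The mesh $\mathcal G$ is analysis-suitable if $\mathcal R_{\mathrm x}\cap\mathcal R_{\mathrm y}=\mathcal R_{\mathrm y}\cap\mathcal R_{\mathrm z}=\mathcal R_{\mathrm z}\cap\mathcal R_{\mathrm x}=\emptyset$. $\mathbb{AS}^{\mathbf p}$ is the set of analysis-suitable meshes. *)

(* Defs.v *)
From mathcomp Require Import all_boot all_order all_algebra.
From mathcomp Require Import boolp classical_sets reals exp.

Set Implicit Arguments.
Unset Strict Implicit.
Unset Printing Implicit Defensive.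

Import Order.TTheory GRing.Theory Num.Theory.

Local Open Scope classical_set_scope.
Local Open Scope ring_scope.

(* The axes x, y, z are the elements 0, 1, 2 of 'I_3, so that every notion
   introduced "analogously" in the three directions is parametrised by an axis.
   The degrees p and the sizes N of the domain are functions 'I_3 -> nat. *)

Section Boxes.
Variable R : realType.

Definition point := 'rV[R]_3.

Definition subst_coord (v : point) (i : 'I_3) (t : R) : point :=
  \row_j (if j == i then t else v 0 j).

(* The closed box with lowest corner K.1 and highest corner K.2. *)
Definition box := (point * point)%type.

Definition lo (K : box) (i : 'I_3) : R := K.1 0 i.
Definition hi (K : box) (i : 'I_3) : R := K.2 0 i.

Definition points_of (K : box) : set point :=
  [set x | forall i, lo K i <= x 0 i <= hi K i].

Definition volume (K : box) : R := \prod_i (hi K i - lo K i).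

Definition mid (K : box) : point := \row_i ((lo K i + hi K i) / 2).

Definition Dist (K : box) (x : point) : point :=
  \row_i `|mid K 0 i - x 0 i|.

(* - log_m |K|; the elements of a mesh have volume m ^ - k with k : nat, and
   truncn is only the cast from R to nat (see levelE). *)
Definition level (m : nat) (K : box) : nat :=
  Num.truncn (- (ln (volume K) / ln (m%:R : R))).

Lemma levelE (m k : nat) (K : box) :
  (1 < m)%N -> volume K = m%:R ^- k -> level m K = k.
Proof.
move=> m1 vK; have m1R : 1 < m%:R :> R by rewrite ltr1n.
have m0 : 0 < m%:R :> R by rewrite (lt_trans ltr01).
rewrite /level vK lnV ?posrE ?exprn_gt0// lnXn// mulNr opprK.
by rewrite mulrnAl divff ?natrK// gt_eqF// ln_gt0.
Qed.

End Boxes.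

Section Meshes.
Variable R : realType.
Notation box := (box R).
Notation point := (point R).

Definition mesh := set box.

Implicit Types (p N : 'I_3 -> nat) (m : nat) (G : mesh) (K : box).

Definition Omega N : set point :=
  [set x | forall i, 0 < x 0 i < (N i)%:R].

Definition initial_mesh N : mesh :=
  [set K | exists2 c : 'I_3 -> nat, forall i, (1 <= c i <= N i)%N
         & K = (\row_i ((c i)%:R - 1), \row_i (c i)%:R)].

Definition split_axis m K : 'I_3 := inord (level m K %% 3).

Definition slice m K (j : nat) : box :=
  let i := split_axis m K in
  let h := (hi K i - lo K i) / m%:R in
  (subst_coord K.1 i (lo K i + j%:R * h),
   subst_coord K.2 i (lo K i + j.+1%:R * h)).

Definition child m K : set box := [set slice m K j | j in [set j | (j < m)%N]].

Definition subdiv m G K : mesh := (G `\ K) `|` child m K.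

(* A finite set M = {K_1, ..., K_J} of elements is given by a duplicate-free
   enumeration. *)
Definition subdivs m G (M : seq box) : mesh := foldl (subdiv m) G M.

(* The exponents -k/3, -(k-1)/3, -(k-2)/3 of the three residue classes of k
   modulo 3 are all -(k %/ 3); the first k %% 3 axes carry a further 1/m. *)
Definition Dvec p m (k : nat) : point :=
  \row_i (m%:R ^- (k %/ 3) *
    (if (i < k %% 3)%N then ((p i)%:R + 3 / 2) / m%:R else (p i)%:R + 3 / 2)).

Definition U p m N K : set point :=
  [set x | Omega N x /\ forall i, Dist K x 0 i < Dvec p m (level m K) 0 i].

Definition patch p m N G K : set box :=
  [set K' | G K' /\ points_of K' `&` U p m N K !=set0].

Definition admissible_subdiv p m N G K : Prop :=
  G K /\ forall K', patch p m N G K K' -> (level m K <= level m K')%N.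

Fixpoint admissible_succession p m N G (s : seq box) : Prop :=
  if s is K :: s' then
    admissible_subdiv p m N G K /\
    admissible_succession p m N (subdiv m G K) s'
  else True.

Definition admissible_subdivs p m N G (M : seq box) : Prop :=
  exists2 s, perm_eq s M & admissible_succession p m N G s.

Definition admissible_meshes p m N : set mesh :=
  [set G | exists (J : nat) (Gs : nat -> mesh) (Ms : nat -> seq box),
    [/\ Gs 0%N = initial_mesh N, Gs J = G &
        forall j, (j < J)%N ->
          [/\ uniq (Ms j), [set` Ms j] `<=` Gs j,
              Gs j.+1 = subdivs m (Gs j) (Ms j) &
              admissible_subdivs p m N (Gs j) (Ms j)]]].

Definition nodes G : set point :=
  [set v | exists2 K, G K & forall i, v 0 i = lo K i \/ v 0 i = hi K i].

Definition active_region p N : set point :=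
  [set x | forall i,
    (uphalf (p i))%:R <= x 0 i <= (N i)%:R - (uphalf (p i))%:R].

Definition active_nodes p N G : set point := nodes G `&` active_region p N.

Definition skeleton G (i : 'I_3) : set point :=
  [set x | exists K, [/\ G K, x 0 i = lo K i \/ x 0 i = hi K i &
                         forall j, j != i -> lo K j <= x 0 j <= hi K j]].

(* For i = 0 this is X(v_2, v_3): it does not depend on v_1. *)
Definition global_index N G (i : 'I_3) (v : point) : set R :=
  [set t | 0 <= t <= (N i)%:R /\ skeleton G i (subst_coord v i t)].

(* s consists of p_i + 2 consecutive elements of the global index set, and its
   middle entry, numbered (p_i + 3) / 2 when counting from 1, is v_i. *)
Definition is_local_index p N G (i : 'I_3) (v : point) (s : seq R) : Prop :=
  [/\ size s = (p i + 2)%N, sorted <%R s, [set` s] `<=` global_index N G i v,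
      forall t, global_index N G i v t -> head 0 s <= t <= last 0 s -> t \in s
    & nth 0 s ((p i + 3)./2).-1 = v 0 i].

(* The closed support of the blending function B_v: the product over the axes
   of the intervals from the first to the last entry of the (unique) local
   index vectors. *)
Definition supp_B p N G (v : point) : set point :=
  [set x | forall i, exists2 s, is_local_index p N G i v s
                              & head 0 s <= x 0 i <= last 0 s].

Definition slice_AR p N (i : 'I_3) (q : R) : set point :=
  [set x | active_region p N x /\ x 0 i = q].

Definition nodes_at p N G (i : 'I_3) (q : R) : set point :=
  [set v | active_nodes p N G v /\ skeleton G i (subst_coord v i q)].

Definition Rset_at p N G (i : 'I_3) (q : R) : set point :=
  slice_AR p N i q
  `&` \bigcup_(v in nodes_at p N G i q) supp_B p N G v
  `&` \bigcup_(v in active_nodes p N G `\` nodes_at p N G i q) supp_B p N G v.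

Definition Rset p N G (i : 'I_3) : set point :=
  \bigcup_(q in [set: R]) Rset_at p N G i q.

Definition analysis_suitable_meshes p N : set mesh :=
  [set G | forall i j : 'I_3, i != j -> Rset p N G i `&` Rset p N G j = set0].

End Meshes.

(* Main.v *)
Require Import Defs.
From mathcomp Require Import all_boot all_order all_algebra.
From mathcomp Require Import boolp classical_sets reals.
From mathcomp Require Import zify ring lra.

Set Implicit Arguments.
Unset Strict Implicit.
Unset Printing Implicit Defensive.

Local Open Scope classical_set_scope.

Import Order.TTheory GRing.Theory Num.Theory.

(** Admissibility is replaced by a property of the final mesh [G] alone,
    together with the set [S] of all boxes that were subdivided on the way to
    it: no element of [G] that meets [U A] is coarser than [A], for every [A] in
    [S] ([refinement_patch_level]). It is checked when [A] is subdivided, and later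
    subdivisions only raise levels.

    Two facts turn this into statements about T-splines. First, close to [A] the
    skeleton contains all grid planes of the level of [A] ([near_skeleton]);
    here one may even stand on the boundary of [U A], since an element through
    such a point, chosen on the side of [A], meets the open set [U A]. Secondly,
    with n = (p_i + 1) / 2, a local index vector has only n - 1 entries strictly
    between its middle and either end ([supp_few_knots]). Hence, where the
    skeleton is as fine as the grid of [A], the i-th coordinates of a node [v]
    and of a point of [supp B_v] are at most about n cells apart
    ([near_few_knots]).

    Suppose now that [x] lies in [R_i]. The node [v] which has the plane through
    [x] in its skeleton shows that some [A] in [S] was cut across axis [i] along
    a plane containing [x] ([face_split]), and [x] is within n cells of [A]
    ([support_near]). If [B] in [S] is any strictly finer box within n cells of
    which [x] lies, every active node [w] with [x] in [supp B_w] is within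
    2n = p_i + 1 cells of [B], that is, in the closure of [U B] ([node_near]).
    This is the crucial step, and it goes by induction on the level of [B]:
    passing from a box to its child changes the widths along a single axis, and
    for that axis the line through [w] already runs in the closure of [U] of the
    child. Then the grid plane through [x] belongs to the skeleton at [w] as
    well, so no [w] can witness that [x] lies in [R_i] ([Rset_coarser]).

    A point of [R_i] and [R_j] provides such boxes [A] and [B] cut across [i]
    and [j]. The level modulo 3 determines the axis of a cut, so their levels
    differ when [i != j], and the finer one refutes membership for the axis of the
    coarser one. *)

(** * Intervals and sorted sequences *)

Section Intervals.
Local Open Scope ring_scope.

(** Asking the slice to leave room on the side of [z] makes the choice at a
    common end point of two slices compatible with moving from [t] to [z]. *)
Lemma half_open_subinterval (R : realFieldType) (l h t z : R) (n : nat) :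
  0 < h -> (0 < n)%N ->
  l <= t <= l + n%:R * h -> (t < z -> t < l + n%:R * h) -> (z < t -> l < t) ->
  exists2 k, (k < n)%N &
    [/\ l + k%:R * h <= t <= l + k.+1%:R * h,
        t < z -> t < l + k.+1%:R * h & z < t -> l + k%:R * h < t].
Proof.
move=> h0; elim: n => // n IHn _ /andP[lt tn] up dn.
have [n0|n0] := posnP n.
  exists 0%N => //; rewrite n0 in tn up.
  by rewrite mul0r addr0 lt tn; split.
have IH : t <= l + n%:R * h -> (t < z -> t < l + n%:R * h) ->
    exists2 k, (k < n.+1)%N & [/\ l + k%:R * h <= t <= l + k.+1%:R * h,
      t < z -> t < l + k.+1%:R * h & z < t -> l + k%:R * h < t].
  move=> tn' up'; have ltn : l <= t <= l + n%:R * h by rewrite lt.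
  have [k kn ?] := IHn n0 ltn up' dn.
  by exists k => //; exact: ltnW.
have last_slice : l + n%:R * h <= t -> (z < t -> l + n%:R * h < t) ->
    exists2 k, (k < n.+1)%N & [/\ l + k%:R * h <= t <= l + k.+1%:R * h,
      t < z -> t < l + k.+1%:R * h & z < t -> l + k%:R * h < t].
  by move=> nt dn'; exists n => //; rewrite nt tn; split.
have [tlt|tgt|tE] := ltgtP t (l + n%:R * h).
- exact: IH (ltW tlt) (fun=> tlt).
- exact: last_slice (ltW tgt) (fun=> tgt).
- have /orP[tz|zt] : (t < z) || (z <= t) by case: ltP.
    by apply: last_slice; rewrite -?tE// => /(lt_trans tz); rewrite ltxx.
  by apply: IH; rewrite ?tE// -tE => /(le_lt_trans zt); rewrite ltxx.
Qed.

(** A point that may only lie in the closure of the open interval of radius [d]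
    around [c] can be moved slightly towards [c], so as to fall inside it
    without leaving [[l, u]]. *)
Lemma shift_towards (R : realFieldType) (l u c d n t : R) :
  l <= t <= u -> (t < c -> t < u) -> (c < t -> l < t) ->
  0 < t < n -> 0 <= c <= n -> 0 < d -> c - d <= t <= c + d ->
  exists y, [/\ l <= y <= u, 0 < y < n & `|c - y| < d].
Proof.
move=> ltu up dn tn cn d0 tcd; have [tc|ct|tE] := ltgtP t c.
- have tu := up tc; exists ((t + Num.min c u) / 2).
  rewrite ltr_norml; case: (leP c u) => cu; split; lra.
- have lt := dn ct; exists ((t + Num.max c l) / 2).
  rewrite ltr_norml; case: (leP c l) => cu; split; lra.
- exists t; rewrite ltr_norml; split; lra.
Qed.

Lemma sorted_between (R : realDomainType) (s T : seq R) (a b : nat) :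
  sorted <%R s -> uniq T -> (a < b < size s)%N ->
  (forall t, t \in T -> t \in s /\ nth 0 s a < t < nth 0 s b) ->
  (size T < b - a)%N.
Proof.
move=> s_sorted uT /andP[ab bs] Ts.
have ltE := lt_sorted_ltn_nth 0 s_sorted.
rewrite -(size_map (index ^~ s)) -[(b - a)%N](subnSK ab) ltnS.
rewrite -(size_iota a.+1 (b - a.+1)); apply: uniq_leq_size.
  rewrite map_inj_in_uniq// => t t' /Ts[ts _] /Ts[t's _] /(congr1 (nth 0 s)).
  by rewrite !nth_index.
move=> _ /mapP[t /Ts[ts /andP[at_ tb]] ->]; rewrite mem_iota subnKC//.
have is_ : (index t s < size s)%N by rewrite index_mem.
have a_lt : (a < index t s)%N.
  by rewrite -ltE ?inE ?(ltn_trans ab)// nth_index.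
have lt_b : (index t s < b)%N by rewrite -ltE ?inE// nth_index.
by rewrite a_lt lt_b.
Qed.

End Intervals.

(** * The hierarchy of cells *)

Section Refinement.
Local Open Scope ring_scope.

Variables (R : realType) (p N : 'I_3 -> nat) (m : nat).
Hypotheses (p_ge3 : forall i, (3 <= p i)%N) (p_odd : forall i, odd (p i)).
Hypotheses (N_gt0 : forall i, (0 < N i)%N) (m_gt1 : (1 < m)%N).

Local Notation point := (Defs.point R).
Implicit Types (G : mesh R) (S : set (box R)) (K A B : box R).
Implicit Types (x v w : point) (i j : 'I_3) (b k : nat) (t r : R).

Let mR_gt0 : 0 < m%:R :> R.
Proof. by rewrite ltr0n; lia. Qed.

Definition cuts i b : nat := (b %/ 3 + (i < b %% 3))%N.

Lemma cutsS i b : cuts i b.+1 = (cuts i b + (i == inord (b %% 3)))%N.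
Proof.
rewrite /cuts -val_eqE /= inordK ?ltn_mod//.
have := ltn_ord i; lia.
Qed.

Lemma cuts0 i : cuts i 0 = 0%N.
Proof. by rewrite /cuts div0n mod0n. Qed.

Lemma leq_cuts i b b' : (b <= b')%N -> (cuts i b <= cuts i b')%N.
Proof. rewrite /cuts; lia. Qed.

Definition width i b : R := m%:R ^- cuts i b.

Definition on_grid i b t : Prop := t * m%:R ^+ cuts i b \is a Num.int.

Lemma width_gt0 i b : 0 < width i b.
Proof. by rewrite invr_gt0 exprn_gt0. Qed.

Lemma widthK i b : width i b * m%:R ^+ cuts i b = 1.
Proof. by rewrite mulVf// expf_neq0// gt_eqF. Qed.

(** The exponents [cuts i b] of the three axes add up to [b]. This is what makes
    the level of a box, defined through its volume, its depth of subdivision. *)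
Lemma prod_width b : \prod_i width i b = m%:R ^- b.
Proof.
rewrite prodfV -expr_sum /=.
congr (_ ^+ _)^-1.
by rewrite !big_ord_recr big_ord0 /cuts /=; lia.
Qed.

Lemma on_gridW i b b' t : (b <= b')%N -> on_grid i b t -> on_grid i b' t.
Proof.
move=> /(leq_cuts i) le_bb' tb; rewrite /on_grid -(subnKC le_bb') exprD mulrA.
by rewrite rpredM// rpredX// natr_int.
Qed.

Lemma on_grid_addMn i b t k :
  on_grid i b t -> on_grid i b (t + k%:R * width i b).
Proof.
by move=> tb; rewrite /on_grid mulrDl -mulrA widthK mulr1 rpredD// natr_int.
Qed.

Lemma on_grid_subMn i b t k :
  on_grid i b t -> on_grid i b (t - k%:R * width i b).
Proof.
by move=> tb; rewrite /on_grid mulrBl -mulrA widthK mulr1 rpredB// natr_int.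
Qed.

Lemma on_grid_next i b t : on_grid i b t -> on_grid i b (t + width i b).
Proof.
by move=> tb; rewrite -[width i b]mul1r; exact: on_grid_addMn 1%N tb.
Qed.

(** The boxes of level [b] of the uniform hierarchy over the domain. *)
Definition cell b K := forall i,
  [/\ on_grid i b (lo K i), hi K i = lo K i + width i b, 0 <= lo K i
    & hi K i <= (N i)%:R].

Lemma cell_level b K : cell b K -> level m K = b.
Proof.
move=> cK; apply: levelE => //; rewrite /volume -prod_width.
apply: eq_bigr => i _; have [_ -> _ _] := cK i; ring.
Qed.

Lemma cell_lo_lt_hi b K i : cell b K -> lo K i < hi K i.
Proof. by move=> /(_ i)[_ -> _ _]; rewrite ltrDl width_gt0. Qed.

Lemma initial_cell K : initial_mesh N K -> cell 0 K.
Proof.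
move=> [c cN ->] i; rewrite /on_grid /width cuts0 expr0 invr1 !mulr1.
rewrite /lo /hi /= !mxE.
have /andP[c1 cN'] := cN i; split.
- by rewrite rpredB ?natr_int ?rpred1.
- by rewrite subrK.
- by rewrite subr_ge0 ler1n.
- by rewrite ler_nat.
Qed.

Lemma subst_coordE v i j t :
  subst_coord v i t 0 j = if j == i then t else v 0 j.
Proof. by rewrite mxE. Qed.

Lemma lo_slice K k i : lo (slice m K k) i =
  if i == split_axis m K then lo K i + k%:R * ((hi K i - lo K i) / m%:R)
  else lo K i.
Proof. by rewrite /lo /= mxE; case: eqP => // ->. Qed.

Lemma hi_slice K k i : hi (slice m K k) i =
  if i == split_axis m K then lo K i + k.+1%:R * ((hi K i - lo K i) / m%:R)
  else hi K i.
Proof. by rewrite /hi /= mxE; case: eqP => // ->. Qed.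

Lemma widthS i b : width i b.+1 =
  if i == inord (b %% 3) then width i b / m%:R else width i b.
Proof.
rewrite /width cutsS; case: eqP => _; rewrite ?addn0// addn1 exprSr.
by rewrite invfM.
Qed.

Lemma child_cell b K K' : cell b K -> child m K K' -> cell b.+1 K'.
Proof.
move=> cK [k /= km <-] i; rewrite lo_slice hi_slice /split_axis (cell_level cK).
have [gi hiE lo0 hiN] := cK i.
have gi' : on_grid i b.+1 (lo K i) by apply: on_gridW gi.
have w0 := width_gt0 i b.
case: eqP => [iE|/eqP/negPf niE]; last by split=> //; rewrite hiE widthS niE.
have wE : width i b.+1 = width i b / m%:R by rewrite widthS iE eqxx.
have -> : (hi K i - lo K i) / m%:R = width i b.+1 by rewrite hiE addrC addKr wE.
split.
- exact: on_grid_addMn.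
- by rewrite -natr1; ring.
- by rewrite addr_ge0// mulr_ge0// ltW// width_gt0.
- apply: le_trans hiN; rewrite hiE lerD2l wE mulrA ler_pdivrMr//.
  by rewrite mulrC ler_pM2l// ler_nat.
Qed.

Lemma child_bounds b K K' i : cell b K -> child m K K' ->
  lo K i <= lo K' i /\ hi K' i <= hi K i.
Proof.
move=> cK [k /= km <-]; rewrite lo_slice hi_slice; case: eqP => // _.
have w0 := cell_lo_lt_hi i cK.
have s0 : 0 < (hi K i - lo K i) / m%:R by rewrite divr_gt0// subr_gt0.
split; first by rewrite lerDl mulr_ge0// ltW.
rewrite -lerBrDl mulrA ler_pdivrMr// mulrC ler_pM2l ?subr_gt0//.
by rewrite ler_nat.
Qed.

Lemma child_other_axis K K' i : child m K K' -> i != split_axis m K ->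
  lo K' i = lo K i /\ hi K' i = hi K i.
Proof.
by move=> [k _ <-] /negPf iK; rewrite lo_slice hi_slice iK.
Qed.

Lemma box_eqP K B :
  (forall i, lo K i = lo B i) -> (forall i, hi K i = hi B i) -> K = B.
Proof.
case: K B => [l u] [l' u'] /= eq_lo eq_hi.
by congr pair; apply/rowP => i; [exact: eq_lo|exact: eq_hi].
Qed.

Lemma on_gridE i b t : on_grid i b t -> exists z : int, t = z%:~R * width i b.
Proof.
move=> /intrP[z zE]; exists z.
by rewrite -zE -mulrA [_ ^+ _ * _]mulrC widthK mulr1.
Qed.

(** The corners of the slices of a cell of width [w] are the numbers
    [(z + k / m) * w] with [k < m], in which [z] is an integer part. *)
Lemma child_inj b K B K' : cell b K -> cell b B ->
  child m K K' -> child m B K' -> K = B.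
Proof.
move=> cK cB chK chB.
suff eq_lo i : lo K i = lo B i.
  by apply: box_eqP => // i; have [_ -> _ _] := cK i; have [_ -> _ _] := cB i;
     rewrite eq_lo.
have axE : split_axis m B = split_axis m K.
  by rewrite /split_axis (cell_level cK) (cell_level cB).
have [iax|niax] := eqVneq i (split_axis m K); last first.
  have [<- _] := child_other_axis chK niax.
  by rewrite -axE in niax; have [<- _] := child_other_axis chB niax.
have [k /= km Kk] := chK; have [k' /= km' Bk] := chB.
have [/on_gridE[z zE] hK _ _] := cK i; have [/on_gridE[z' zE'] hB _ _] := cB i.
have : lo K' i = lo K' i by [].
rewrite -{1}Kk -Bk !lo_slice axE iax eqxx -iax hK hB.
rewrite !(addrC (lo _ _)) !addrK zE zE'.
have w0 := width_gt0 i b; set w := width i b in w0 *.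
rewrite !(mulrCA _ w) !(mulrC _ w) -!mulrDr => /(mulfI (lt0r_neq0 w0)) E.
have {}E : k%:Z + z * m%:Z = k'%:Z + z' * m%:Z.
  apply/eqP; rewrite -(eqr_int R) !rmorphD !rmorphM /= -!pmulrn; apply/eqP.
  have := congr1 (fun u => u * m%:R) E.
  by rewrite !mulrDl !divfK// gt_eqF.
suff -> : z = z' by [].
nia.
Qed.

(** * Refinement histories *)

(** [x] lies in [K], and near [x] the segment from [x] to [z] stays in [K]. *)
Definition points_towards K x (z : point) := forall i,
  [/\ lo K i <= x 0 i <= hi K i, x 0 i < z 0 i -> x 0 i < hi K i
    & z 0 i < x 0 i -> lo K i < x 0 i].

Lemma initial_towards x (z : point) :
  (forall i, 0 <= x 0 i <= (N i)%:R) -> (forall i, 0 <= z 0 i <= (N i)%:R) ->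
  exists2 K, initial_mesh N K & points_towards K x z.
Proof.
move=> xN zN.
have /choice[c cP] : forall i, exists c, (c < N i)%N /\
    [/\ c%:R <= x 0 i <= c.+1%:R, x 0 i < z 0 i -> x 0 i < c.+1%:R
      & z 0 i < x 0 i -> c%:R < x 0 i].
  move=> i; have /andP[x0 x1] := xN i; have /andP[z0 z1] := zN i.
  have [|||c cN] := @half_open_subinterval R 0 1 (x 0 i) (z 0 i) (N i)
    ltr01 (N_gt0 i).
  - by rewrite add0r mulr1 x0.
  - by rewrite add0r mulr1 => /lt_le_trans; apply.
  - exact: le_lt_trans.
  by rewrite !add0r !mulr1 => cP; exists c.
exists (\row_i ((c i).+1%:R - 1), \row_i (c i).+1%:R).
  by exists (fun i => (c i).+1) => // i; have [] := cP i.
by move=> i; rewrite /lo /hi !mxE -natr1 addrK natr1; have [] := cP i.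
Qed.

Lemma child_towards b K x (z : point) : cell b K -> points_towards K x z ->
  exists2 K', child m K K' & points_towards K' x z.
Proof.
move=> cK Kx; set i := split_axis m K.
have w0 : 0 < (hi K i - lo K i) / m%:R.
  by rewrite divr_gt0// subr_gt0 (cell_lo_lt_hi _ cK).
have hiE : lo K i + m%:R * ((hi K i - lo K i) / m%:R) = hi K i.
  by rewrite mulrC divfK ?gt_eqF// addrC subrK.
have [Kxi up dn] := Kx i; rewrite -hiE in Kxi up.
have [k km kP] := half_open_subinterval w0 (ltnW m_gt1) Kxi up dn.
exists (slice m K k); first by exists k.
move=> j; rewrite lo_slice hi_slice -/i; by case: eqP => [->|_].
Qed.

(** [S] is the history of the mesh: all the boxes subdivided so far, that is,
    the inner vertices of the forest whose leaves are the elements of [G]. *)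
Inductive refinement : mesh R -> set (box R) -> Prop :=
| refinement_initial : refinement (initial_mesh N) set0
| refinement_subdiv G S K : refinement G S -> admissible_subdiv p m N G K ->
    refinement (subdiv m G K) (K |` S).

Lemma refinement_cell G S K : refinement G S -> G K \/ S K ->
  cell (level m K) K.
Proof.
move=> GS; elim: GS K => {G S} [|G S B GS IH [GB _]] K.
  by case=> // /initial_cell cK; rewrite (cell_level cK).
case=> [[[GK _]|BK]|[->|SK]];
  [by apply: IH; left| |by apply: IH; left|by apply: IH; right].
have cB := IH B (or_introl GB).
by have cK := child_cell cB BK; rewrite (cell_level cK).
Qed.

Lemma refinement_parent G S K : refinement G S -> G K \/ S K ->
  initial_mesh N K \/ exists2 B, S B & child m B K.
Proof.
move=> GS; elim: GS K => {G S} [|G S B GS IH [GB _]] K.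
  by case=> // GK; left.
have keep : G K \/ S K ->
    initial_mesh N K \/ exists2 A, (B |` S) A & child m A K.
  by move=> /IH[|[A SA AK]]; [left|right; exists A => //; right].
case=> [[[GK _]|BK]|[->|SK]]; [by apply: keep; left| | |by apply: keep; right].
  by right; exists B => //; left.
have [|[A SA AK]] := IH B (or_introl GB); [by left|].
by right; exists A => //; right.
Qed.

(** A child of [K] that is already present would have [K] as its only possible
    parent in [S]. *)
Lemma refinement_child_unsplit G S K K' :
  refinement G S -> G K -> child m K K' -> ~ S K -> ~ (G K' \/ S K').
Proof.
move=> GS GK KK' nSK GK'; apply: nSK.
have cK := refinement_cell GS (or_introl GK).
have cK' := child_cell cK KK'.
have [/initial_cell c0|[B SB BK']] := refinement_parent GS GK'.
  by have := cell_level cK'; rewrite (cell_level c0).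
have cB := refinement_cell GS (or_intror SB).
have lBK : level m B = level m K.
  by have := cell_level (child_cell cB BK'); rewrite (cell_level cK') => -[].
by rewrite lBK in cB; rewrite (child_inj cK cB KK' BK').
Qed.

Lemma refinement_disjoint G S K : refinement G S -> G K -> ~ S K.
Proof.
move=> GS; elim: GS K => {G S} [|G S B GS IH [GB _]] K; first by move=> _ [].
have cB := refinement_cell GS (or_introl GB).
case=> [[GK KB] [//|]|BK [KB|SK]]; first exact: IH.
  have := cell_level (child_cell cB BK); rewrite KB; lia.
exact: (refinement_child_unsplit GS GB BK (IH _ GB) (or_intror SK)).
Qed.

(** No two elements of a mesh are parent and child, whence the independence of
    the order in which a set of elements is subdivided. *)
Lemma refinement_child_notin G S K K' : refinement G S -> G K -> child m K K' ->
  ~ G K'.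
Proof.
move=> GS GK KK' GK'.
have nSK := refinement_disjoint GS GK.
exact: (refinement_child_unsplit GS GK KK' nSK (or_introl GK')).
Qed.

Lemma refinement_towards G S x (z : point) : refinement G S ->
  (forall i, 0 <= x 0 i <= (N i)%:R) -> (forall i, 0 <= z 0 i <= (N i)%:R) ->
  exists2 K, G K & points_towards K x z.
Proof.
move=> GS xN zN; elim: GS => {G S} [|G S B GS [K GK Kx] [GB _]].
  exact: initial_towards.
have [KB|/eqP KB] := eqVneq K B; last by exists K => //; left.
rewrite KB in Kx.
have cB := refinement_cell GS (or_introl GB).
by have [K' BK' K'x] := child_towards cB Kx; exists K' => //; right.
Qed.

(** A child of an element lies in its parent and has a higher level, so that
    what the admissible subdivision of [A] requires of its patch is kept by all
    later subdivisions. *)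
Lemma refinement_patch_level G S A K : refinement G S -> S A -> G K ->
  points_of K `&` U p m N A !=set0 -> (level m A <= level m K)%N.
Proof.
move=> GS; elim: GS A K => {G S} [|G S B GS IH [GB Bmin]] A K; first by case.
move=> SA GK [y [Ky Uy]].
have cB := refinement_cell GS (or_introl GB).
suff : exists2 K', G K' & points_of K' y /\ (level m K' <= level m K)%N.
  move=> [K' GK' [K'y le_K'K]]; apply: leq_trans le_K'K.
  have meet : points_of K' `&` U p m N A !=set0 by exists y.
  case: SA => [AB|SA]; last exact: IH.
  by rewrite AB in meet *; apply: Bmin.
case: GK => [[GK _]|BK]; first by exists K.
exists B => //; split.
  move=> i; have [lei gei] := child_bounds i cB BK; have /andP[lo1 hi1] := Ky i.
  by rewrite (le_trans lei lo1) (le_trans hi1 gei).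
by rewrite (cell_level (child_cell cB BK)).
Qed.

(** * Meshes reached by admissible subdivisions *)

(** The right-hand side depends only on the set of entries of [M]. *)
Lemma subdivsE G (M : seq (box R)) :
  (forall K K', K \in M -> K' \in M -> ~ child m K K') ->
  subdivs m G M =
    (G `\` [set` M]) `|` [set K' | exists2 K, K \in M & child m K K'].
Proof.
elim: M G => [|B M IH] G indep.
  apply/seteqP; split=> K /=; first by left.
  by case=> [[]|[]].
rewrite /subdivs /= -/(subdivs m (subdiv m G B) M) IH; last first.
  by move=> K K' KM K'M; apply: indep; rewrite inE ?KM ?K'M orbT.
apply/seteqP; split=> K /=.
- case=> [[[[GK /eqP KB]|BK] KM]|[A AM AK]].
  + by left; split=> //; rewrite inE => /orP[/(negP KB)|/KM].
  + by right; exists B; rewrite ?mem_head.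
  + by right; exists A; rewrite // inE AM orbT.
- case=> [[GK KBM]|[A + AK]].
  + left; split; last by move=> KM; apply: KBM; rewrite inE KM orbT.
    by left; split=> // KB; apply: KBM; rewrite KB mem_head.
  + rewrite inE => /predU1P[AB|AM]; last by right; exists A.
    rewrite AB in AK; left; split; first by right.
    by move=> KM; apply: (indep B K _ _ AK); rewrite ?mem_head// inE KM orbT.
Qed.

Lemma refinement_succession G S s : refinement G S ->
  admissible_succession p m N G s -> exists S', refinement (subdivs m G s) S'.
Proof.
elim: s G S => [|K s IH] G S GS /=; first by exists S.
move=> [GK /(IH _ (K |` S))]; apply; exact: refinement_subdiv.
Qed.

Lemma admissible_refinement G : admissible_meshes p m N G ->
  exists S, refinement G S.
Proof.
move=> [J [Gs [Ms [Gs0 <- step]]]].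
elim: J step => [|J IH] step; first by exists set0; rewrite Gs0; constructor.
have [S GS] := IH (fun n nJ => step n (ltnW nJ)).
have [_ MG -> [s sM s_adm]] := step J (ltnSn J).
suff -> : subdivs m (Gs J) (Ms J) = subdivs m (Gs J) s.
  exact: refinement_succession GS s_adm.
have indep K K' : K \in Ms J -> K' \in Ms J -> ~ child m K K'.
  move=> /MG GK /MG GK' KK'; exact: refinement_child_notin GS GK KK' GK'.
rewrite !subdivsE//; last by move=> K K'; rewrite !(perm_mem sM); exact: indep.
by apply/seteqP; split=> K /=; rewrite (perm_mem sM) => -[?|[A AM ?]];
   [left|right; exists A|left|right; exists A] => //;
   rewrite ?(perm_mem sM)// -?(perm_mem sM).
Qed.

(** * The skeleton close to a subdivided box *)

Lemma dvecE i b : Dvec R p m b 0 i = ((p i)%:R + 3 / 2) * width i b.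
Proof.
rewrite mxE /width /cuts.
case: ifP => _; rewrite ?addn0 ?addn1 ?exprSr ?invfM; ring.
Qed.

(** The slab around [K] obtained by adding [k] copies of [K] on both sides along
    axis [i]. For [k = p i + 1] and all [i] these slabs intersect in the closure
    of [U p m N K], up to the boundary of the domain. *)
Definition near k K i t : Prop :=
  lo K i - k%:R * (hi K i - lo K i) <= t <= hi K i + k%:R * (hi K i - lo K i).

Lemma U_cell b K x : cell b K -> Omega N x ->
  (forall i, `|mid K 0 i - x 0 i|
             < ((p i).+1%:R + 1 / 2) * (hi K i - lo K i)) ->
  U p m N K x.
Proof.
move=> cK Nx Kx; split=> // i; rewrite (cell_level cK) dvecE mxE.
apply: lt_le_trans (Kx i) _.
have [_ -> _ _] := cK i; rewrite (addrC (lo K i)) addrK -natr1; lra.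
Qed.

Lemma near_widen k k' b K i t : cell b K -> (k <= k')%N ->
  near k K i t -> near k' K i t.
Proof.
move=> /(cell_lo_lt_hi i); rewrite -subr_gt0 /near -(ler_nat R) => w0 kk'.
have := ler_wpM2r (ltW w0) kk'; lra.
Qed.

Lemma near_parent k b K K' i t : cell b K -> child m K K' ->
  near k K' i t -> near k K i t.
Proof.
move=> cK KK'; have [lei gei] := child_bounds i cK KK'.
have : k%:R * (hi K' i - lo K' i) <= k%:R * (hi K i - lo K i).
  by rewrite ler_wpM2l//; lra.
rewrite /near; lra.
Qed.

(** No grid plane of its own level, nor of a lower one, passes through the
    interior of a cell. *)
Lemma cell_skeleton G b b' K x i : cell b' K -> (b <= b')%N -> G K ->
  points_of K x -> on_grid i b (x 0 i) -> skeleton G i x.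
Proof.
move=> cK bb' GK Kx /(on_gridW bb')/on_gridE[z zE]; exists K; split=> //.
have [/on_gridE[c cE] hE _ _] := cK i; have := Kx i; rewrite hE zE cE.
have w0 := width_gt0 i b'; set w := width i b' in w0 *.
have -> : c%:~R * w + w = (c + 1)%:~R * w by rewrite rmorphD /= mulrDl mul1r.
rewrite !ler_pM2r// !ler_int => cz.
have [->|->] : z = c \/ z = c + 1 by lia.
  by left.
by right.
Qed.

(** The element is chosen on the side of [mid A], so that it meets the open set
    [U p m N A] although [x] may lie on its boundary. *)
Lemma near_skeleton G S A x i : refinement G S ->
  S A -> Omega N x -> (forall j, near (p j).+1 A j (x 0 j)) ->
  on_grid i (level m A) (x 0 i) -> skeleton G i x.
Proof.
move=> GS SA xN xA xg.
have cA := refinement_cell GS (or_intror SA).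
have midN j : 0 <= mid A 0 j <= (N j)%:R.
  by rewrite mxE; have [_ _ ? ?] := cA j; have := cell_lo_lt_hi j cA; lra.
have xcN j : 0 <= x 0 j <= (N j)%:R by have /andP[/ltW-> /ltW->] := xN j.
have [K GK Kx] := refinement_towards GS xcN midN.
have /choice[y yP] : forall j, exists y, [/\ lo K j <= y <= hi K j,
    0 < y < (N j)%:R
    & `|mid A 0 j - y| < ((p j).+1%:R + 1 / 2) * (hi A j - lo A j)].
  move=> j; have [xK up dn] := Kx j.
  apply: shift_towards xK up dn (xN j) (midN j) _ _.
    by rewrite mulr_gt0 ?subr_gt0 ?(cell_lo_lt_hi _ cA)// addr_gt0// divr_gt0.
  by have := xA j; rewrite /near mxE; lra.
have lAK : (level m A <= level m K)%N.
  have yE j : (\row_j y j) 0 j = y j by rewrite mxE.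
  apply: (refinement_patch_level GS SA GK _); exists (\row_j y j); split.
    by move=> j; rewrite yE; have [] := yP j.
  by apply: U_cell cA _ _ => j; rewrite yE; have [] := yP j.
apply: (cell_skeleton (refinement_cell GS (or_introl GK)) lAK GK _ xg).
by move=> j; have [] := Kx j.
Qed.

Lemma integer_skeleton G S x i : refinement G S ->
  Omega N x -> on_grid i 0 (x 0 i) -> skeleton G i x.
Proof.
move=> GS xN xg.
have xcN j : 0 <= x 0 j <= (N j)%:R by have /andP[/ltW-> /ltW->] := xN j.
have [K GK Kx] := refinement_towards GS xcN xcN.
apply: (cell_skeleton (refinement_cell GS (or_introl GK)) (leq0n _) GK _ xg).
by move=> j; have [] := Kx j.
Qed.

(** * Knots and supports *)

(** [v] matters only through the line parallel to axis [i] on which it lies;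
    [a] and [c] are two positions on that line. *)
Definition few_knots_between G i v (a c : R) : Prop := forall T : seq R,
  uniq T ->
  (forall t, t \in T ->
     [/\ global_index N G i v t, Num.min a c < t & t < Num.max a c]) ->
  (size T < uphalf (p i))%N.

(** All knots in the range of the local index vector are entries of it, and
    strictly between its middle entry, of index [n], and its ends, of index [0]
    and [2n], there are [n - 1] entries on either side. *)
Lemma supp_few_knots G v x i : supp_B p N G v x ->
  few_knots_between G i v (v 0 i) (x 0 i).
Proof.
move=> /(_ i)[s [s_size s_sorted _ s_all s_mid] /andP[hx xl]] T uT TP.
set n := uphalf (p i).
have pE : (p i).+1 = (n + n)%N.
  by have := odd_double_half (p i); rewrite /n uphalf_half p_odd; lia.
have n0 : (0 < n)%N by lia.
have midE : (((p i + 3)./2).-1 = n)%N by rewrite /n uphalf_half p_odd; lia.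
have szE : size s = (n + n).+1 by rewrite s_size; lia.
have headE : head 0 s = nth 0 s 0 by rewrite nth0.
have lastE : last 0 s = nth 0 s (n + n) by rewrite -nth_last szE.
rewrite midE in s_mid; rewrite headE in hx; rewrite lastE in xl.
have nth_lt := lt_sorted_ltn_nth 0 s_sorted.
have h_lt : nth 0 s 0 < nth 0 s n by rewrite nth_lt ?inE ?szE//; lia.
have l_gt : nth 0 s n < nth 0 s (n + n)%N by rewrite nth_lt ?inE ?szE//; lia.
rewrite -s_mid in TP.
have Ts t : t \in T -> nth 0 s 0 <= t <= nth 0 s (n + n) -> t \in s.
  by move=> /TP[tk _ _] ?; apply: s_all; rewrite ?headE ?lastE.
case: (leP (x 0 i) (nth 0 s n)) => xv.
- rewrite -[n]subn0; apply: (sorted_between s_sorted uT).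
    by rewrite szE n0 ltnS leq_addr.
  move=> t tT; have [_ lo_t hi_t] := TP t tT.
  have ht : nth 0 s 0 < t < nth 0 s n.
    by move: lo_t hi_t; rewrite (min_r xv) (max_l xv); lra.
  by split=> //; apply: Ts => //; lra.
- rewrite -[n](addnK n); apply: (sorted_between s_sorted uT).
    by rewrite szE ltnSn -[X in (X < _)%N]addn0 ltn_add2l n0.
  move=> t tT; have [_ lo_t hi_t] := TP t tT.
  have ht : nth 0 s n < t < nth 0 s (n + n).
    by move: lo_t hi_t; rewrite (min_l (ltW xv)) (max_r (ltW xv)); lra.
  by split=> //; apply: Ts => //; lra.
Qed.

Lemma few_knots_betweenC G i v a c :
  few_knots_between G i v a c -> few_knots_between G i v c a.
Proof. by rewrite /few_knots_between minC maxC. Qed.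

(** If [c] were farther away, the [(p i + 1) / 2] grid coordinates next to the
    slab of [a], on the side of [c], would all be knots between [a] and [c]. One
    of [a] and [c] is the coordinate of a node and the other that of a point in
    the support of its blending function, in either role. *)
Lemma near_few_knots k G A v i (a c : R) : cell (level m A) A ->
  few_knots_between G i v a c ->
  (forall t, 0 < t < (N i)%:R -> near (k + uphalf (p i)) A i t ->
     on_grid i (level m A) t -> skeleton G i (subst_coord v i t)) ->
  0 < a < (N i)%:R -> 0 < c < (N i)%:R ->
  near k A i a -> near (k + uphalf (p i)) A i c.
Proof.
move=> cA few knot aN cN ka; set n := uphalf (p i) in knot *.
have [gl hE _ _] := cA i; set w := width i (level m A) in hE.
have wE : hi A i - lo A i = w by rewrite hE addrC addKr.
have w0 : 0 < w by exact: width_gt0.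
have gh : on_grid i (level m A) (hi A i).
  by rewrite hE; exact: on_grid_next.
have knots (f : nat -> R) : injective f -> (forall l, (l < n)%N ->
    [/\ near (k + n) A i (f l), on_grid i (level m A) (f l)
      & Num.min a c < f l < Num.max a c]) -> False.
  move=> f_inj fP.
  have := few [seq f l | l <- iota 0 n].
  rewrite size_map size_iota ltnn map_inj_uniq// iota_uniq => /(_ erefl) H.
  suff: false by [].
  apply: H => _ /mapP[l + ->].
  rewrite mem_iota /= add0n => /fP[nf gf /andP[f1 f2]].
  have fN : 0 < f l < (N i)%:R.
    move: f1 f2; rewrite gt_min lt_max => /orP[] ? /orP[] ?; lra.
  split=> //; split; last exact: knot.
  by case/andP: fN => /ltW-> /ltW->.
have ka' := ka; rewrite /near wE in ka'.
have step l : (l < n)%N -> [/\ 0 <= (k + l.+1)%:R * w,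
    k%:R * w < (k + l.+1)%:R * w & (k + l.+1)%:R * w <= (k + n)%:R * w].
  move=> ln; rewrite mulr_ge0 ?(ltW w0)// ltr_pM2r// ler_pM2r//.
  by rewrite ltr_nat ler_nat; split=> //; lia.
have inj l l' : (k + l.+1)%:R * w = (k + l'.+1)%:R * w -> l = l'.
  by move=> /(mulIf (lt0r_neq0 w0))/eqP; rewrite eqr_nat => /eqP; lia.
rewrite /near wE; apply/andP; split; rewrite leNgt; apply/negP => far.
- apply: (knots (fun l => lo A i - (k + l.+1)%:R * w)).
    by move=> l l' /addrI/oppr_inj/inj.
  move=> l /step[s0 s1 s2]; split; last 1 first.
  + by rewrite gt_min lt_max; apply/andP; split; apply/orP; [right|left]; lra.
  + by rewrite /near wE; lra.
  + exact: on_grid_subMn.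
- apply: (knots (fun l => hi A i + (k + l.+1)%:R * w)).
    by move=> l l' /addrI/inj.
  move=> l /step[s0 s1 s2]; split; last 1 first.
  + by rewrite gt_min lt_max; apply/andP; split; apply/orP; [left|right]; lra.
  + by rewrite /near wE; lra.
  + exact: on_grid_addMn.
Qed.

Lemma active_Omega x : active_region p N x -> Omega N x.
Proof.
move=> xA i; have /andP[x1 x2] := xA i.
have : 0 < (uphalf (p i))%:R :> R by rewrite ltr0n; have := p_ge3 i; lia.
lra.
Qed.

Lemma Omega_subst v i t : Omega N v -> 0 < t < (N i)%:R ->
  Omega N (subst_coord v i t).
Proof. by move=> vN tN j; rewrite subst_coordE; case: eqP => // ->. Qed.

(** Only [v], moved to the plane through [x], is known to lie in [A]; so the
    first step bounds the distance of [v] itself from [A], along axis [j]. After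
    that the lines through [v] along the other axes stay in the region where the
    skeleton is fine. *)
Lemma support_near G S A v x j : refinement G S ->
  S A -> active_region p N v -> active_region p N x -> supp_B p N G v x ->
  points_of A (subst_coord v j (x 0 j)) ->
  forall i, near (uphalf (p i)) A i (x 0 i).
Proof.
move=> GS SA /active_Omega vN /active_Omega xN vx Av.
have cA := refinement_cell GS (or_intror SA).
have n_le i : (uphalf (p i) <= (p i).+1)%N by lia.
have near0 i : i != j -> near 0 A i (v 0 i).
  by move=> /negPf ij; have := Av i; rewrite subst_coordE ij /near; lra.
have xj0 : near 0 A j (x 0 j).
  by have := Av j; rewrite subst_coordE eqxx /near; lra.
have vj : near (uphalf (p j)) A j (v 0 j).
  (* [x] is the starting point here: its [j]-th coordinate is within [A]. *)
  rewrite -[uphalf _]add0n.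
  apply: (near_few_knots cA (few_knots_betweenC (supp_few_knots (i := j) vx))
    _ (xN j) (vN j) xj0).
  move=> t tN At tg; apply: (near_skeleton GS SA _ _ _);
    last by rewrite subst_coordE eqxx.
    exact: Omega_subst.
  move=> l; rewrite subst_coordE; case: eqP => [->|/eqP lj].
    exact: near_widen cA (n_le j) At.
  exact: near_widen cA (leq0n _) (near0 _ lj).
move=> i; have [->|ij] := eqVneq i j; first exact: near_widen cA (leq0n _) xj0.
rewrite -[uphalf _]add0n.
apply: (near_few_knots cA (supp_few_knots (i := i) vx)
  _ (vN i) (xN i) (near0 _ ij)).
move=> t tN At tg; apply: (near_skeleton GS SA _ _ _);
  last by rewrite subst_coordE eqxx.
  exact: Omega_subst.
move=> l; rewrite subst_coordE; case: eqP => [->|_].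
  exact: near_widen cA (n_le i) At.
have [->|lj] := eqVneq l j; first exact: near_widen cA (n_le j) vj.
exact: near_widen cA (leq0n _) (near0 _ lj).
Qed.

(** By induction on the level of [A]: at level 0 all integer coordinates are
    knots, wherever [w] is. If [A] is a child of [B], the claim for [B] settles
    the axes across which [B] is not cut, since [A] and [B] have the same extent
    there. This places the line through [w] along the remaining axis within the
    closure of [U p m N A], where the grid of [A] supplies the knots. *)
Lemma node_near G S A w x : refinement G S ->
  S A -> active_region p N w -> active_region p N x -> supp_B p N G w x ->
  (forall i, near (uphalf (p i)) A i (x 0 i)) ->
  forall i, near (p i).+1 A i (w 0 i).
Proof.
move=> GS + /active_Omega wN /active_Omega xN wx.
have pE i : (p i).+1 = (uphalf (p i) + uphalf (p i))%N.
  by have := odd_double_half (p i); rewrite uphalf_half p_odd; lia.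
move: {2}(level m A) (erefl (level m A)) => b.
elim: b A => [|b IH] A lA SA xA.
  have cA := refinement_cell GS (or_intror SA) => i; rewrite pE.
  apply: (near_few_knots cA (few_knots_betweenC (supp_few_knots (i := i) wx))
    _ (xN i) (wN i) (xA i)).
  move=> t tN _; rewrite lA => tg; apply: (integer_skeleton GS _ _);
    last by rewrite subst_coordE eqxx.
  exact: Omega_subst.
have cA := refinement_cell GS (or_intror SA).
have [/initial_cell/cell_level|[B SB BA]] :=
  refinement_parent GS (or_intror SA).
  by rewrite lA.
have cB := refinement_cell GS (or_intror SB).
have lB : level m B = b.
  by have := cell_level (child_cell cB BA); rewrite lA => -[].
have wB := IH B lB SB (fun i => near_parent cB BA (xA i)).
have other i : i != split_axis m B -> near (p i).+1 A i (w 0 i).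
  by move=> /(child_other_axis BA)[lE hE]; rewrite /near lE hE; exact: wB.
move=> i; have [iB|] := eqVneq i (split_axis m B); last exact: other.
rewrite pE.
apply: (near_few_knots cA (few_knots_betweenC (supp_few_knots (i := i) wx))
  _ (xN i) (wN i) (xA i)).
move=> t tN At tg; apply: (near_skeleton GS SA _ _ _);
  last by rewrite subst_coordE eqxx.
  exact: Omega_subst.
move=> l; rewrite subst_coordE; case: eqP => [->|/eqP li]; first by rewrite pE.
by apply: other; rewrite -iB.
Qed.

Lemma support_skeleton G S A w x i : refinement G S ->
  S A -> active_region p N w -> active_region p N x -> supp_B p N G w x ->
  (forall j, near (uphalf (p j)) A j (x 0 j)) ->
  on_grid i (level m A) (x 0 i) ->
  skeleton G i (subst_coord w i (x 0 i)).
Proof.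
move=> GS SA wA xA wx near_x xg.
have cA := refinement_cell GS (or_intror SA).
have wN := active_Omega wA; have xN := active_Omega xA.
apply: (near_skeleton GS SA _ _ _);
  last by rewrite subst_coordE eqxx.
  exact: Omega_subst.
move=> j; rewrite subst_coordE; case: eqP => [->|_].
  by apply: near_widen cA _ (near_x i); lia.
exact: node_near GS SA wA xA wx near_x j.
Qed.

(** * Analysis-suitability *)

(** Going up from [K] to its ancestor in the initial mesh, whose faces have
    integer coordinates, there is a last box with a face at [r]; its parent was
    cut there. *)
Lemma face_split G S K i r : refinement G S -> G K \/ S K ->
  r = lo K i \/ r = hi K i -> ~ on_grid i 0 r ->
  exists A, [/\ S A, points_of K `<=` points_of A, split_axis m A = i
    & on_grid i (level m A).+1 r].
Proof.
move=> GS + + nr.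
move: {2}(level m K) (erefl (level m K)) => b.
elim: b K => [|b IH] K lK GSK rK; have cK := refinement_cell GS GSK.
  case: nr; have [lg hE _ _] := cK i; rewrite lK in lg hE.
  case: rK => -> //; rewrite hE; exact: on_grid_next.
have [/initial_cell/cell_level|[B SB BK]] := refinement_parent GS GSK.
  by rewrite lK.
have cB := refinement_cell GS (or_intror SB).
have lB : level m B = b.
  by have := cell_level (child_cell cB BK); rewrite lK => -[].
have KB : points_of K `<=` points_of B.
  move=> x Kx l; have [lel gel] := child_bounds l cB BK.
  by have /andP[x1 x2] := Kx l; rewrite (le_trans lel x1) (le_trans x2 gel).
have [iB|iB] := eqVneq i (split_axis m B).
  exists B; split=> //; have [lg hE _ _] := child_cell cB BK i.
  case: rK => -> //; rewrite hE; exact: on_grid_next.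
have [lE hE] := child_other_axis BK iB; rewrite lE hE in rK.
have [A [SA BA Ai Ag]] := IH B lB (or_intror SB) rK.
by exists A; split=> //; apply: subset_trans BA.
Qed.

Lemma Rset_split G S i x : refinement G S ->
  Rset p N G i x ->
  active_region p N x /\ (exists A, [/\ S A, split_axis m A = i,
     on_grid i (level m A).+1 (x 0 i)
   & forall j, near (uphalf (p j)) A j (x 0 j)]) /\
  exists w, [/\ active_region p N w, supp_B p N G w x &
     ~ skeleton G i (subst_coord w i (x 0 i))].
Proof.
move=> GS [q _ [[[xA <-] [v [[_ vA] vi] vx]] [w [[w_node wA] wi] wx]]].
have xN := active_Omega xA; have vN := active_Omega vA.
have wN := active_Omega wA.
have nw : ~ skeleton G i (subst_coord w i (x 0 i)).
  by move=> ?; apply: wi; split.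
split=> //; split; last by exists w.
have [K [GK xK vK]] := vi; rewrite subst_coordE eqxx in xK.
have [|A [SA KA Ai Ag]] := face_split GS (or_introl GK) xK.
  move=> xg; apply: nw; apply: (integer_skeleton GS _ _);
    last by rewrite subst_coordE eqxx.
  exact: Omega_subst.
exists A; split=> //; apply: (support_near GS SA vA xA vx _) => //.
apply: KA => j; have [->|ji] := eqVneq j i; last exact: vK.
have cK := refinement_cell GS (or_introl GK); have := cell_lo_lt_hi i cK.
by rewrite subst_coordE eqxx; case: xK => ->; rewrite lexx => /ltW->.
Qed.

Lemma Rset_coarser G S i j A A' x : refinement G S ->
  S A' -> (level m A < level m A')%N -> on_grid i (level m A).+1 (x 0 i) ->
  (forall l, near (uphalf (p l)) A' l (x 0 l)) -> ~ Rset p N G i x.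
Proof.
move=> GS SA' lt_lev xg near_x /(Rset_split GS)[xA [_ [w [wA wx]]]]; apply.
exact: support_skeleton GS SA' wA xA wx near_x (on_gridW lt_lev xg).
Qed.

Lemma admissible_analysis_suitable G :
  admissible_meshes p m N G -> analysis_suitable_meshes p N G.
Proof.
move=> /admissible_refinement[S GS] i j ij.
apply/seteqP; split=> // x [xi xj] /=.
have [_ [[A [SA Ai Ag Ax]] _]] := Rset_split GS xi.
have [_ [[B [SB Bj Bg Bx]] _]] := Rset_split GS xj.
have [AB|BA|E] := ltngtP (level m A) (level m B).
- exact: Rset_coarser GS SB AB Ag Bx xi.
- exact: Rset_coarser GS SA BA Bg Ax xj.
- by move: ij; rewrite -Ai -Bj /split_axis E eqxx.
Qed.

End Refinement.

Theorem theorem5p3 (R : realType) (p N : 'I_3 -> nat)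
    (hp3 : forall i, 3 <= p i) (hpodd : forall i, odd (p i))
    (hN : forall i, 0 < N i) (m : nat) (hm : 2 <= m) :
  @admissible_meshes R p m N `<=` @analysis_suitable_meshes R p N.
Proof. by move=> G; exact: admissible_analysis_suitable. Qed.
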